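(* Let $f(n)$ denote the smallest positive integer such that every set of $f(n)$ points in general position in the Euclidean plane contains $n$ points that are the vertices of a convex $n$-gon. Then $$\limsup_{n\to\infty} \frac{f(n)}{\binom{2n-5}{n-2}} \le \frac{29}{32}.$$
   Context: General position means no three points are collinear. *)

(* Defs.v *)
From HB Require Import structures.
From mathcomp Require Import all_boot all_order all_algebra finmap.
From mathcomp Require Import all_classical all_reals all_analysis.

Set Implicit Arguments.
Unset Strict Implicit.
Unset Printing Implicit Defensive.

Import Order.TTheory GRing.Theory Num.Theory.
Import numFieldNormedType.Exports.

Local Open Scope classical_set_scope.
Local Open Scope ring_scope.

Notation plane R := 'rV[R]_2.

Definition line (R : realType) (a v : plane R) : set (plane R) :=
  [set x | exists t : R, x = a + t *: v].

Definition collinear (R : realType) (p q r : plane R) : Prop :=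
  exists a v : plane R,
    v != 0 /\ [/\ line a v p, line a v q & line a v r].

Definition general_position (R : realType) (S : {fset plane R}) : Prop :=
  forall p q r, p \in S -> q \in S -> r \in S ->
    p != q -> q != r -> p != r -> ~ collinear p q r.

Definition convex_hull (R : realType) (A : set (plane R)) : set (plane R) :=
  smallest (@convex_set R (plane R)) A.

Definition extreme_points (R : realType) (A : set (plane R)) :
    set (plane R) :=
  [set x | A x /\ forall (y z : plane R) (t : R), A y -> A z ->
     0 < t -> t < 1 -> x = t *: y + (1 - t) *: z -> y = x /\ z = x].

(* The vertices of a convex polygon are its extreme points, so T is the vertex
   set of a convex polygon when every point of T is a vertex of the polygon
   convex_hull T.  If T has at least three points, this forces them not to lie
   on one line.  For n <= 2 the "n-gons" are degenerate: the empty set, points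
   and segments. *)
Definition convex_gon_vertices (R : realType) (n : nat) (T : {fset plane R}) :
    Prop :=
  #|` T| = n /\ extreme_points (convex_hull [set` T]) = [set` T].

Definition forces_convex_gon (R : realType) (n m : nat) : Prop :=
  forall S : {fset plane R}, #|` S| = m -> general_position S ->
    exists T : {fset plane R}, (T `<=` S)%fset /\ convex_gon_vertices n T.

Definition is_smallest_forcing (R : realType) (n m : nat) : Prop :=
  [/\ (0 < m)%N, forces_convex_gon R n m &
      forall k : nat, (0 < k)%N -> forces_convex_gon R n k -> (m <= k)%N].

Lemma is_smallest_forcing_unique (R : realType) (n m m' : nat) :
  is_smallest_forcing R n m -> is_smallest_forcing R n m' -> m = m'.
Proof.
move=> [m0 mP m_min] [m'0 m'P m'_min]; apply/eqP.
by rewrite eqn_leq m_min// m'_min.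
Qed.

(* Main.v *)
(* The ratio even tends to 0.  A positive fraction of the points splits into a
   bounded number of clusters such that every transversal is a cap (or every
   one is a cup).  As in Suk's work on the problem, in a cluster lying between
   two reference points [a] and [b] of the cap, one separates the pairs of
   points whose line passes between [a] and [b] from the other pairs.
   If all pairs of a set are of the first kind, the set is nested, and two
   nested chains of 4k points in two clusters between the same [a] and [b],
   bulging away from each other, form a convex 8k-gon; so, in one of the two
   clusters, nested sets have at most 'C(12k, 4k) points.  If all pairs of a set
   are of the second kind, its caps extend those of the other clusters, and 8
   caps of k points form a convex 8k-gon; hence such sets have at most
   'C(9k, k) points.  Altogether O('C(9k, k) 'C(12k, 4k)) points force a convex
   8k-gon, and this is exponentially smaller than 4 ^ (8k), essentially because
   3 ^ 30 < 2 ^ 48. *)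
Require Import Defs.
From HB Require Import structures.
From mathcomp Require Import all_boot all_order all_algebra finmap.
From mathcomp Require Import all_classical all_reals all_analysis.
From mathcomp Require Import zify ring lra.

Set Implicit Arguments.
Unset Strict Implicit.
Unset Printing Implicit Defensive.

Import Order.TTheory GRing.Theory Num.Theory.
Import numFieldNormedType.Exports.

Local Open Scope ring_scope.

(** * Monochromatic chains of triples *)

Section Triples.
Variable T : eqType.
Implicit Types (c : T -> T -> T -> bool) (r lt : rel T) (s t : seq T).

Fixpoint path3 c s : bool :=
  if s is x :: s' then
    (if s' is y :: z :: _ then c x y z else true) && path3 c s'
  else true.

Fixpoint all3 c s : bool :=
  if s is x :: s' then pairwise (c x) s' && all3 c s' else true.

(** An overlap of two points suffices, because any three consecutive points of the union lie in one
    of the two paths. *)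
Lemma path3_cat c x y s t :
  path3 c (rcons s x ++ [:: y]) -> path3 c (x :: y :: t) ->
  path3 c (rcons s x ++ y :: t).
Proof.
elim: s => [//|z [|w s] IH] /=; first by case/andP=> -> _ /= ->.
rewrite /= in IH.
case/andP => h1 h2 h3; rewrite IH // andbT.
by move: h1; case: s {IH h2 h3} => [|? []].
Qed.

(* The colouring is arbitrary: no transitivity is needed as long as only
   consecutive triples are asked to be monochromatic. *)
Lemma erdos_szekeres_triples lt c1 c2 (a b : nat) s :
  uniq s ->
  {in s &, forall x y, x != y -> lt x y || lt y x} ->
  {in s & &, forall x y z, lt x y -> lt y z -> c1 x y z || c2 x y z} ->
  ('C(a + b, a) < size s)%N ->
  exists t, [/\ {subset t <= s}, sorted lt t &
    (size t == a.+2) && path3 c1 t || (size t == b.+2) && path3 c2 t].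
Proof.
have [k] := ubnP (a + b)%N.
elim: k => // k IH in a b s * => abk us tot col hs.
have pair_case : (1 < size s)%N ->
    exists x y, [/\ x \in s, y \in s & lt x y].
  case: s us tot {col hs} => [//|x [//|y s]] /andP[xNs _] tot _.
  have xy : x != y by apply: contraNneq xNs => ->; rewrite mem_head.
  have [] := orP (tot x y _ _ xy); rewrite ?inE ?eqxx ?orbT //.
    by exists x, y; rewrite !inE !eqxx !orbT.
  by exists y, x; rewrite !inE !eqxx !orbT.
(* When [a] or [b] is 0, two comparable points are enough: a path of two points has no triple to
   colour. *)
case: a abk hs => [|a] abk hs.
  have [|x [y [xs ys xy]]] := pair_case; first by rewrite bin0 in hs.
  exists [:: x; y]; split; rewrite /= ?xy // => z; rewrite !inE.
  by case/orP => /eqP ->.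
case: b abk hs => [|b] abk hs.
  have [|x [y [xs ys xy]]] := pair_case; first by rewrite addn0 binn in hs.
  exists [:: x; y]; split; rewrite /= ?xy ?orbT // => z; rewrite !inE.
  by case/orP => /eqP ->.
(* [P x]: some [c1]-chain of [a.+2] points, one short of the goal, ends at [x]. Pascal's rule splits
   the bound between such ends and the other points. *)
pose P x := exists t, [/\ {subset rcons t x <= s}, sorted lt (rcons t x),
   size t = a.+1 & path3 c1 (rcons t x)].
pose E x := `[< P x >].
have szE : size s = (size (seq.filter E s) + size (seq.filter (predC E) s))%N.
  by rewrite !size_filter count_predC.
have uf D : uniq (seq.filter D s) by exact: filter_uniq.
have tf D : {in seq.filter D s &, forall x y, x != y -> lt x y || lt y x}.
  by move=> x y; rewrite !mem_filter => /andP[_ ?] /andP[_ ?]; exact: tot.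
have cf D : {in seq.filter D s & &,
    forall x y z, lt x y -> lt y z -> c1 x y z || c2 x y z}.
  move=> x y z; rewrite !mem_filter => /andP[_ ?] /andP[_ ?] /andP[_ ?].
  exact: col.
have binE : 'C(a.+1 + b.+1, a.+1) = ('C(a + b.+1, a) + 'C(a.+1 + b, a.+1))%N.
  by rewrite addSn binS addnC addSnnS.
have [h0|h0] := ltnP 'C(a + b.+1, a) (size (seq.filter (predC E) s)).
  have [|t [ts st]] := IH a b.+1 _ _ (uf _) (tf _) (cf _) h0; first by lia.
  case/orP => [/andP[/eqP sz p1]|h]; last first.
    exists t; split=> //; last by rewrite h orbT.
    by move=> x /ts; rewrite mem_filter => /andP[].
  case/lastP: t => [//|t x] in ts st sz p1 *.
  have /ts : x \in rcons t x by rewrite mem_rcons mem_head.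
  rewrite mem_filter => /andP[/= /asboolP []]; exists t; split=> //.
    by move=> y /ts; rewrite mem_filter => /andP[].
  by move: sz; rewrite size_rcons => -[].
have h1 : ('C(a.+1 + b, a.+1) < size (seq.filter E s))%N by lia.
have [|t [ts st]] := IH a.+1 b _ _ (uf _) (tf _) (cf _) h1; first by lia.
have tsub : {subset t <= s}.
  by move=> x /ts; rewrite mem_filter => /andP[].
case/orP => [h|/andP[/eqP sz p2]]; first by exists t; rewrite h.
case: t => [//|x [//|y t]] in ts st sz p2 tsub *.
have /ts : x \in x :: y :: t by rewrite mem_head.
rewrite mem_filter => /andP[/= /asboolP [u [us' su szu p1]] xs].
have ys : y \in s by apply: tsub; rewrite !inE eqxx orbT.
move: st => /= /andP[xy st].
case/lastP: u => [//|u w] in us' su szu p1.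
have ws : w \in s by apply: us'; rewrite !(mem_rcons, inE) eqxx orbT.
have wx : lt w x.
  by move: su; rewrite -!cats1 -catA => /cat_sorted2[_] /=; rewrite andbT.
(* A [c1]-chain ends with [w], [x] and a [c2]-chain starts with [x], [y]; the colour of [w], [x],
   [y] tells which of them gains a point. *)
have [cwxy|cwxy] := orP (col w x y ws xs ys wx xy).
  exists (rcons (rcons u w) x ++ [:: y]); split.
  - move=> v; rewrite mem_cat => /orP[/us'//|]; rewrite inE => /eqP -> //.
  - case: (u) su => [|u0 u'] /=; first by rewrite wx xy.
    by rewrite cat_path last_rcons /= => ->; rewrite xy.
  - apply/orP; left; apply/andP; split.
      by move: szu; rewrite size_cat !size_rcons addn1 => -[->].
    rewrite -(cats1 (rcons u w)) -catA /=.
    by apply: path3_cat; [rewrite cats1|rewrite /= cwxy].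
exists (w :: x :: y :: t); split.
- by move=> v; rewrite inE => /orP[/eqP ->//|/tsub].
- by rewrite /= wx xy.
- apply/orP; right; apply/andP; split; first by move: sz => /= ->.
  by rewrite -[path3 _ _]/(c2 w x y && path3 c2 [:: x, y & t]) cwxy.
Qed.

(** Induction on [h]: the elements without predecessor form a free set. If they are at most [v],
    they are removed, and a chain among the remaining elements can be prolonged at its head. *)
Lemma chain_or_free lt r (h v : nat) s :
  uniq s -> (h * v < size s)%N ->
  (exists t, [/\ uniq t, {subset t <= s}, (v < size t)%N &
     {in t &, forall x y, lt x y -> ~~ r x y}]) \/
  (exists t, [/\ {subset t <= s}, size t = h.+1 &
     sorted (fun x y => lt x y && r x y) t]).
Proof.
elim: h s => [|h IH] s us hs.
  case: s us hs => // x s _ _; right; exists [:: x]; split=> // y.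
  by rewrite !inE => /eqP ->; rewrite eqxx.
pose E x := has (fun y => lt y x && r y x) s.
have szE : size s = (size (seq.filter E s) + size (seq.filter (predC E) s))%N.
  by rewrite !size_filter count_predC.
have [h0|h0] := ltnP v (size (seq.filter (predC E) s)).
  left; exists (seq.filter (predC E) s); split=> //.
  - by rewrite filter_uniq.
  - by move=> x; rewrite mem_filter => /andP[].
  move=> x y; rewrite !mem_filter => /andP[_ xs].
  by move=> /andP[/= /hasPn /(_ _ xs) h1 _] xy; rewrite xy in h1.
have h1 : (h * v < size (seq.filter E s))%N by rewrite mulSn in hs; lia.
have [|[t [ut ts vt ht]]|[t [ts szt st]]] := IH (seq.filter E s) _ h1.
- by rewrite filter_uniq.
- left; exists t; split=> // x /ts; rewrite mem_filter => /andP[] //.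
right; case: t => [//|x t] in ts szt st *.
have /ts : x \in x :: t by rewrite mem_head.
rewrite mem_filter => /andP[/hasP[y ys yx] xs].
exists (y :: x :: t); split; last 2 first.
- by move: szt => /= ->.
- by rewrite /= yx.
move=> z; rewrite inE => /orP[/eqP -> //|/ts].
by rewrite mem_filter => /andP[].
Qed.

(** Four-point transitivity spreads the colour: first to the triples [x y w] through the first two
    points, then to [x u w] by way of [x y u] and [y u w]. *)
Lemma path3_all3 (P : {pred T}) lt c s :
  (forall x y z w, [/\ x \in P, y \in P, z \in P & w \in P] ->
     pairwise lt [:: x; y; z; w] ->
     c x y z -> c y z w -> c x y w && c x z w) ->
  {subset s <= P} -> pairwise lt s -> path3 c s -> all3 c s.
Proof.
move=> tr; elim: s => [//|x s IH] sP /= /andP[xs ps] /andP[c1 p3].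
have sP' : {subset s <= P} by move=> y ys; apply: sP; rewrite inE ys orbT.
have a3 := IH sP' ps p3; rewrite a3 andbT.
have xP : x \in P by apply: sP; rewrite mem_head.
case: s => [//|y s] in sP' xs ps a3 p3 c1 {IH sP} *.
move: xs ps a3 => /= /andP[xy xs] /andP[ys ps] /andP[cy a3].
have yP : y \in P by apply: sP'; rewrite mem_head.
case: s => [//|z s] in sP' xs ys ps a3 cy c1 {p3} *.
have zP : z \in P by apply: sP'; rewrite !inE eqxx orbT.
have cxy : all (c x y) (z :: s).
  move: cy xs ys ps => /= /andP[cy _] /andP[xz xs] /andP[yz ys] /andP[zs _].
  rewrite c1 /=; apply/allP => w ws.
  have wP : w \in P by apply: sP'; rewrite !inE ws !orbT.
  have pw : pairwise lt [:: x; y; z; w].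
    by rewrite /= xy xz (allP xs _ ws) yz (allP ys _ ws) (allP zs _ ws).
  by case/andP: (tr x y z w (And4 xP yP zP wP) pw c1 (allP cy _ ws)).
rewrite cxy.
have sP2 : {subset z :: s <= P} by move=> w ws; apply: sP'; rewrite inE ws orbT.
elim: (z :: s) sP2 xs ys ps cy cxy => [//|u l IH] lP /= /andP[xu xl]
  /andP[yu yl] /andP[ul pl] /andP[cyu cy] /andP[cxu cx].
have lP' : {subset l <= P} by move=> w ws; apply: lP; rewrite inE ws orbT.
move: (IH lP' xl yl pl cy cx) => /= ->; rewrite andbT; apply/allP => w wl.
have uP : u \in P by apply: lP; rewrite mem_head.
have pw : pairwise lt [:: x; y; u; w].
  by rewrite /= xy xu (allP xl _ wl) yu (allP yl _ wl) (allP ul _ wl).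
by case/andP: (tr x y u w (And4 xP yP uP (lP' _ wl)) pw cxu (allP cyu _ wl)).
Qed.

Lemma all3_cat c s t :
  all3 c s -> all3 c t ->
  {in t, forall z, pairwise (fun x y => c x y z) s} ->
  {in s, forall x, pairwise (c x) t} -> all3 c (s ++ t).
Proof.
elim: s => [//|x s IH] /= /andP[xs as_] at_ h1 h2.
rewrite IH // ?pairwise_cat ?xs ?h2 ?mem_head //= ?andbT.
- apply/allrelP => y z ys /h1 /andP[/allP/(_ _ ys) //].
- by move=> z /h1 /andP[].
- by move=> y ys; apply: h2; rewrite inE ys orbT.
Qed.

Lemma sub_all3 c c' s :
  (forall x y z, c x y z -> c' x y z) -> all3 c s -> all3 c' s.
Proof.
move=> cc'; elim: s => [//|x s IH] /= /andP[px /IH ->].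
by rewrite andbT; apply: sub_pairwise px => y z; exact: cc'.
Qed.

Lemma pairwise_total lt s : pairwise lt s ->
  {in s &, forall x y, x != y -> lt x y || lt y x}.
Proof.
elim: s => [//|z s IH] /= /andP[/allP zs /IH {}IH] x y.
rewrite !inE => /orP[/eqP ->|xs] /orP[/eqP ->|ys]; first by rewrite eqxx.
- by rewrite zs.
- by rewrite zs // orbT.
- exact: IH.
Qed.

Lemma pairwise_rev lt s : pairwise lt (rev s) = pairwise (fun x y => lt y x) s.
Proof.
elim: s => //= x s IH.
by rewrite rev_cons -cats1 pairwise_cat IH allrel1r all_rev /= !andbT.
Qed.

Lemma all3_rev c s : all3 c (rev s) = all3 (fun x y z => c z y x) s.
Proof.
suff H c' t : all3 c' t -> all3 (fun x y z => c' z y x) (rev t).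
  by apply/idP/idP => /H //; rewrite revK.
elim: t => [//|x t IH] /= /andP[xt at_]; rewrite rev_cons -cats1.
apply: all3_cat => //; first exact: IH.
  by move=> z; rewrite inE => /eqP ->; rewrite pairwise_rev.
Qed.

End Triples.

(** * Orientation of triples of points *)

Section Plane.
Variable R : realType.
Implicit Types (p q r u v w : plane R) (s : R).

(* The factor [s], which will be [1] or [-1], lets caps and cups be treated at
   once. *)
Definition orient s p q r : R :=
  s * ((q 0 0 - p 0 0) * (r 0 1 - p 0 1) - (q 0 1 - p 0 1) * (r 0 0 - p 0 0)).

Lemma orient_rot s p q r : orient s q r p = orient s p q r.
Proof. rewrite /orient; ring. Qed.

Lemma orient_swap s p q r : orient s q p r = - orient s p q r.
Proof. rewrite /orient; ring. Qed.

Lemma orientN s p q r : orient (- s) p q r = - orient s p q r.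
Proof. rewrite /orient; ring. Qed.

(** The three-term Grassmann-Plücker relation whose brackets all contain [q]; in the next one they
    all contain [r]. *)
Lemma orient_gp_fst s a p q r u :
  orient s a q r * orient s p q u
  = orient s a p q * orient s q r u + orient s a q u * orient s p q r.
Proof. rewrite /orient; ring. Qed.

Lemma orient_gp_snd s a p q r u :
  orient s a q r * orient s p r u
  = orient s a p r * orient s q r u + orient s a r u * orient s p q r.
Proof. rewrite /orient; ring. Qed.

Lemma neg_comb (a b c x y z : R) :
  a < 0 -> b < 0 -> c < 0 -> a * z = b * x + c * y -> x < 0 -> y < 0 -> z < 0.
Proof.
move=> a0 b0 c0 e x0 y0.
by rewrite -(nmulr_rgt0 _ a0) e addr_gt0 // nmulr_rgt0.
Qed.

Lemma pos_comb (a b c x y z : R) :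
  a < 0 -> b < 0 -> c < 0 -> a * z = b * x + c * y -> 0 < x -> 0 < y -> 0 < z.
Proof.
move=> a0 b0 c0 e x0 y0; rewrite -oppr_lt0.
apply: (@neg_comb a b c (- x) (- y)) => //; rewrite ?oppr_lt0 //.
by rewrite !mulrN e opprD.
Qed.

(* Around a centre [a] that sees the points turning in one direction, the
   triple orientations behave as those of points sorted by abscissa. *)
Lemma orient_around s a p q r u :
  pairwise (fun x y => orient s a x y < 0) [:: p; q; r; u] ->
  orient s p q r < 0 -> orient s q r u < 0 ->
  orient s p q u < 0 /\ orient s p r u < 0.
Proof.
rewrite /= !andbT => /andP[/and3P[apq apr apu] /andP[/andP[aqr aqu] aru]] h1 h2.
split; [exact: neg_comb (orient_gp_fst s a p q r u) _ _|
        exact: neg_comb (orient_gp_snd s a p q r u) _ _].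
Qed.

Lemma orient_around_pos s a p q r u :
  pairwise (fun x y => orient s a x y < 0) [:: p; q; r; u] ->
  0 < orient s p q r -> 0 < orient s q r u ->
  0 < orient s p q u /\ 0 < orient s p r u.
Proof.
rewrite /= !andbT => /andP[/and3P[apq apr apu] /andP[/andP[aqr aqu] aru]] h1 h2.
split; [exact: pos_comb (orient_gp_fst s a p q r u) _ _|
        exact: pos_comb (orient_gp_snd s a p q r u) _ _].
Qed.

(** General position allows two points with the same abscissa, so ties are broken by the
    ordinate. *)
Definition lexle p q := (p 0 0 < q 0 0) || (p 0 0 == q 0 0) && (p 0 1 <= q 0 1).

Lemma plane_eq p q : p 0 0 = q 0 0 -> p 0 1 = q 0 1 -> p = q.
Proof.
move=> h0 h1; apply/rowP => i.
have [->|->] : i = 0 \/ i = 1 :> 'I_2 => //.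
by case: i => [[|[|//]]] hi; [left|right]; exact: val_inj.
Qed.

Lemma lexle_total : total lexle.
Proof.
move=> p q; rewrite /lexle.
by case: (ltgtP (p 0 0) (q 0 0)) => //= _; exact: le_total.
Qed.

Lemma lexle_trans : transitive lexle.
Proof.
move=> q p r /orP[pq|/andP[/eqP pq pq']] /orP[qr|/andP[/eqP qr qr']];
  rewrite /lexle.
- by rewrite (lt_trans pq qr).
- by rewrite -qr pq.
- by rewrite pq qr.
- by rewrite pq qr eqxx (le_trans pq' qr') orbT.
Qed.

Lemma lexle_fst p q : lexle p q -> p 0 0 <= q 0 0.
Proof. by case/orP => [/ltW|/andP[/eqP -> _]]. Qed.

Lemma orient_lex s p q r u :
  pairwise lexle [:: p; q; r; u] ->
  orient s p q r < 0 -> orient s q r u < 0 ->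
  orient s p q u < 0 /\ orient s p r u < 0.
Proof.
rewrite /= !andbT => /andP[/and3P[pq _ _] /andP[/andP[qr _] ru]] h1 h2.
move/lexle_fst: pq; move/lexle_fst: qr; move/lexle_fst: ru => ru qr pq.
have e1 : (r 0 0 - q 0 0) * orient s p q u
  = (q 0 0 - p 0 0) * orient s q r u + (u 0 0 - q 0 0) * orient s p q r.
  by rewrite /orient; ring.
have e2 : (r 0 0 - q 0 0) * orient s p r u
  = (r 0 0 - p 0 0) * orient s q r u + (u 0 0 - r 0 0) * orient s p q r.
  by rewrite /orient; ring.
(* If [q] and [r] are on one vertical line, [e1] puts [p] on it too, against
   [orient s p q r < 0]. *)
have [rq|rq] : r 0 0 = q 0 0 \/ 0 < r 0 0 - q 0 0.
- by move: qr; rewrite le_eqVlt => /orP[/eqP|]; [left|right; rewrite subr_gt0].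
- have pqE : p 0 0 = q 0 0.
    have h3 : 0 <= (q 0 0 - p 0 0) * - orient s q r u.
      by rewrite mulr_ge0 ?subr_ge0 // oppr_ge0 ltW.
    have h4 : 0 <= (u 0 0 - q 0 0) * - orient s p q r.
      by rewrite mulr_ge0 ?subr_ge0 ?(le_trans qr) // oppr_ge0 ltW.
    have : (q 0 0 - p 0 0) * - orient s q r u = 0.
      by move: e1; rewrite rq subrr mul0r; lra.
    by move/eqP; rewrite mulf_eq0 oppr_eq0 (lt_eqF h2) orbF; lra.
  by move: h1; rewrite /orient rq pqE !subrr !(mul0r, mulr0, subr0) ltxx.
split; rewrite -(pmulr_rlt0 _ rq) ?e1 ?e2.
- have h3 : (q 0 0 - p 0 0) * orient s q r u <= 0.
    by rewrite mulr_ge0_le0 ?subr_ge0 // ltW.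
  have : (u 0 0 - q 0 0) * orient s p q r < 0 by rewrite pmulr_rlt0 //; lra.
  lra.
- have h3 : (u 0 0 - r 0 0) * orient s p q r <= 0.
    by rewrite mulr_ge0_le0 ?subr_ge0 // ltW.
  have : (r 0 0 - p 0 0) * orient s q r u < 0 by rewrite pmulr_rlt0 //; lra.
  lra.
Qed.

Lemma orient0_collinear s p q r :
  s != 0 -> p != q -> orient s p q r = 0 -> collinear p q r.
Proof.
move=> s0 pq /eqP; rewrite mulf_eq0 (negPf s0) /= => /eqP e.
exists p, (q - p); split; first by rewrite subr_eq0 eq_sym.
split.
- by exists 0; rewrite scale0r addr0.
- by exists 1; rewrite scale1r addrC subrK.
have [h|h] := eqVneq (q 0 0) (p 0 0).
  have h' : q 0 1 - p 0 1 != 0.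
    by rewrite subr_eq0; apply: contra_neq pq => /esym; apply: plane_eq.
  exists ((r 0 1 - p 0 1) / (q 0 1 - p 0 1)); apply: plane_eq; rewrite !mxE.
    move: e; rewrite h subrr mul0r sub0r mulr0 addr0 => /eqP.
    by rewrite oppr_eq0 mulf_eq0 (negPf h') subr_eq0 => /eqP.
  by rewrite divfK // addrC subrK.
have h' : q 0 0 - p 0 0 != 0 by rewrite subr_eq0.
exists ((r 0 0 - p 0 0) / (q 0 0 - p 0 0)); apply: plane_eq; rewrite !mxE.
  by rewrite divfK // addrC subrK.
move: e => /eqP; rewrite subr_eq0 => /eqP e.
rewrite mulrAC [X in X / _]mulrC -e mulrAC mulfV // mul1r; ring.
Qed.

End Plane.

(** * Convex position *)

Section ConvexPosition.
Variable R : realType.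
Implicit Types (p q : plane R) (S T : {fset plane R}).
Local Open Scope classical_set_scope.

(** A linear functional with coefficients [a] and [b] is smaller at [p] than at all other points of
    [T]. This is easier to verify than extremality in the hull. *)
Definition exposed (T : {pred plane R}) p := exists a b : R,
  {in T, forall q, q != p -> a * p 0 0 + b * p 0 1 < a * q 0 0 + b * q 0 1}.

Lemma convex_setP (A : set (plane R)) :
  (forall (x y : plane R) (k : R), A x -> A y -> 0 < k -> k < 1 ->
     A (k *: x + (1 - k) *: y)) ->
  convex_set (A : set (convex_lmodType (plane R))).
Proof.
move=> cA; apply/convex_setW => x y /set_mem xA /set_mem yA k k0 k1.
by apply/mem_set; exact: cA.
Qed.

Lemma convex_hull_min (A B : set (plane R)) :
  convex_set (B : set (convex_lmodType (plane R))) -> A `<=` B ->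
  convex_hull A `<=` B.
Proof. by move=> cB AB x; apply; split. Qed.

Lemma sub_convex_hull (A : set (plane R)) : A `<=` convex_hull A.
Proof. by move=> x Ax M [_]; apply. Qed.

Lemma convex_hull_conv (A : set (plane R)) (x y : plane R) (k : R) :
  0 < k -> k < 1 -> convex_hull A x -> convex_hull A y ->
  convex_hull A (k *: x + (1 - k) *: y).
Proof.
move=> k0 k1 hx hy M MA; have xM := hx _ MA; have yM := hy _ MA.
case: MA => /convex_setW cM _; apply/set_mem.
exact: (cM x y (mem_set xM) (mem_set yM) (Itv01 (ltW k0) (ltW k1)) k0 k1).
Qed.

(** Removing an extreme point from the hull leaves a convex set, so an extreme point outside [T]
    would contradict minimality. Conversely, [p] together with the open half-plane [phi p < phi q]
    is convex and contains the hull, so [p] is no proper combination. *)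
Lemma exposed_convex_gon_vertices T :
  (forall p, p \in T -> exposed (mem T) p) ->
  convex_gon_vertices #|` T| T.
Proof.
move=> expT; split => //; apply/seteqP; split => [x [hx ex]|p pT].
  apply: contrapT => xT.
  suff /(_ x hx)[//] : convex_hull [set` T] `<=`
      [set z | convex_hull [set` T] z /\ z <> x].
  apply: convex_hull_min => [|z zT]; last first.
    by split; [exact: sub_convex_hull|move=> zx; apply: xT; rewrite -zx].
  apply: convex_setP => y z k [hy yx] [hz zx] k0 k1; split.
    exact: convex_hull_conv.
  by move=> e; have [] := ex y z k hy hz k0 k1 (esym e).
split=> [|y z t hy hz t0 t1 e]; first exact: sub_convex_hull.
have [a [b ab]] := expT p pT.
pose phi (q : plane R) := a * q 0 0 + b * q 0 1.
have phiD (u v : plane R) (k : R) :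
    phi (k *: u + (1 - k) *: v) = k * phi u + (1 - k) * phi v.
  by rewrite /phi !mxE; ring.
pose B : set (plane R) := [set q | q = p \/ phi p < phi q].
have hB : convex_hull [set` T] `<=` B.
  apply: convex_hull_min => [|q qT]; last first.
    by have [->|qp] := eqVneq q p; [left|right; exact: ab].
  apply: convex_setP => u v k uB vB k0 k1.
  have k1' : 0 < 1 - k by rewrite subr_gt0.
  case: uB vB => [->|up] [->|vp].
  - by left; rewrite -scalerDl subrKC scale1r.
  - by right; rewrite phiD; nra.
  - by right; rewrite phiD; nra.
  - by right; rewrite phiD; nra.
have t1' : 0 < 1 - t by rewrite subr_gt0.
have phie := congr1 phi e; rewrite phiD in phie.
case: (hB _ hy) (hB _ hz) => [yp|yp] [zp|zp]; first by [].
- by exfalso; move: phie; rewrite yp; nra.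
- by exfalso; move: phie; rewrite zp; nra.
- by exfalso; nra.
Qed.

(* With [u] the predecessor and [v] the successor of [p] on the polygon, the
   functional is [q |-> orient s u p q + orient s p v q]. *)
Lemma exposed_head (s : R) p (t : seq (plane R)) :
  (1 < size t)%N -> pairwise (fun q r => 0 < orient s p q r) t ->
  exposed (mem (p :: t)) p.
Proof.
case: t => [//|v t]; case/lastP: t => [//|t u] _ pt.
exists (s * (u 0 1 - v 0 1)), (s * (v 0 0 - u 0 0)) => q.
rewrite inE => /orP[/eqP ->|qt _]; first by rewrite eqxx.
suff : 0 < orient s u p q + orient s p v q by rewrite /orient; nra.
rewrite -(orient_rot s u p q).
have dg x y : orient s x y y = 0 by rewrite /orient; ring.
move: pt; rewrite pairwise_cons -cats1 all_cat pairwise_cat allrel1r /=.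
rewrite andbT => /andP[/andP[vt vu] /and3P[tu _ _]].
move: qt; rewrite inE mem_rcons inE => /or3P[/eqP ->|/eqP ->|qt].
- by rewrite dg addr0.
- by rewrite dg add0r.
- by rewrite addr_gt0 ?(allP vt _ qt) ?(allP tu _ qt).
Qed.

(** Orientation is invariant under cyclic shifts, so the list can be rotated until [p] is its
    head. *)
Lemma exposed_of_all3 (s : R) (w : seq (plane R)) :
  (2 < size w)%N -> all3 (fun x y z => 0 < orient s x y z) w ->
  {in w, forall p, exposed (mem w) p}.
Proof.
move=> sw aw p pw; case/splitPr: pw aw sw => w1 w2 aw sw.
have [a [b ab]] : exposed (mem (p :: w2 ++ w1)) p.
  apply: (@exposed_head s); first by move: sw; rewrite !size_cat /=; lia.
  elim: w1 aw {sw} => [|x w1 IH] /=; first by rewrite cats0 => /andP[].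
  case/andP; rewrite pairwise_cat pairwise_cons.
  case/and4P=> xw1 _ xp _ aw.
  have := IH aw; rewrite (pairwise_cat _ w2 w1) => /and3P[h1 h2 h3].
  rewrite -cat1s catA pairwise_cat h3 andbT pairwise_cat h2 /= andbT allrel1r.
  have hx : {in w2, forall y, 0 < orient s p y x}.
    by move=> y yw; rewrite orient_rot; exact: (allP xp).
  rewrite (introT allP hx) andbT allrel_catl h1 /= allrel1l.
  apply/allP => y yw; rewrite -orient_rot.
  by move: xw1 => /allrelP/(_ y p yw); rewrite mem_head => /(_ isT).
exists a, b => q qw; apply: ab; move: qw; rewrite !(mem_cat, inE).
by rewrite orbCA [(q \in w2) || _]orbC.
Qed.

Lemma all3_gon S n (s : R) (w : seq (plane R)) :
  {subset w <= S} -> (2 < size w)%N -> (n <= size w)%N -> uniq w ->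
  all3 (fun x y z => 0 < orient s x y z) w ->
  exists T : {fset plane R}, (T `<=` S)%fset /\ convex_gon_vertices n T.
Proof.
(* Exposure in [w] passes to a prefix; as only [w] needs three points, [n <= 2] is covered as
   well. *)
move=> wS sw nw uw aw; exists [fset x in take n w]%fset; split.
  by apply/fsubsetP => x; rewrite !inE => /mem_take /wS.
have e : #|` [fset x in take n w]%fset| = n.
  by rewrite card_fseq undup_id ?take_uniq // size_takel.
rewrite -[X in convex_gon_vertices X _]e.
apply: exposed_convex_gon_vertices => p; rewrite !inE => /mem_take.
move=> /(exposed_of_all3 sw aw)[a [b ab]]; exists a, b => q.
by rewrite !inE => /mem_take; exact: ab.
Qed.

End ConvexPosition.

(** * Clusters whose transversals are caps *)

Section Counting.

Lemma pigeonhole_rel (A K : finType) (P : A -> K -> bool) :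
  (0 < #|A|)%N -> (forall a, exists k, P a k) ->
  exists k, (#|A| <= #|K| * #|[pred a | P a k]|)%N.
Proof.
move=> A0 AK; apply/existsP; apply: contraT; rewrite negb_exists => /forallP lt.
have K0 : (0 < #|K|)%N.
  by have /card_gt0P[a _] := A0; have [k _] := AK a; apply/card_gt0P; exists k.
have le : (#|A| <= \sum_k #|[pred a | P a k]|)%N.
  rewrite -sum1_card.
  under [leqRHS]eq_bigr => k _ do rewrite -sum1_card big_mkcond /=.
  rewrite exchange_big /=; apply: leq_sum => a _; have [k ak] := AK a.
  by rewrite (bigD1 k) //= inE ak.
have lt2 : (\sum_k #|K| * #|[pred a | P a k]| <= \sum_(k : K) #|A|.-1)%N.
  by apply: leq_sum => k _; have := lt k; rewrite -ltnNge; case: #|A| A0.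
rewrite -big_distrr sum_nat_const /= in lt2.
have := leq_trans (leq_mul (leqnn #|K|) le) lt2.
by rewrite leq_pmul2l // -ltnS prednK // ltnn.
Qed.

(* A dense set of functions has a fibre over its values off [F] that projects
   onto a positive fraction of every factor in [F]: the size of a fibre is at
   most the product of the sizes of its projections. *)
Lemma box_fiber (I T : finType) (E : {pred {ffun I -> T}}) (F : {set I})
    (C : nat) :
  (0 < #|T|)%N -> (#|T| ^ #|I| <= C * #|E|)%N ->
  exists2 f0, f0 \in E &
    forall i, i \in F ->
      (#|T| <= C * #|[set f i | f : {ffun I -> T} in
          [pred f | (f \in E) &&
             [forall j, (j \notin F) ==> (f j == f0 j)]]]|)%N.
Proof.
move=> T0 hE; have /card_gt0P[y0 _] := T0.
pose fiber (f0 : {ffun I -> T}) :=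
  [pred f : {ffun I -> T} | (f \in E) &&
     [forall j, (j \notin F) ==> (f j == f0 j)]].
pose proj f0 i := [set f i | f : {ffun I -> T} in fiber f0].
apply: contrapT => H.
have {}H f0 : f0 \in E -> exists2 i, i \in F & (C * #|proj f0 i| < #|T|)%N.
  move=> f0E; apply: contrapT => H'; apply: H; exists f0 => // i iF.
  by rewrite leqNgt; apply/negP => lt; apply: H'; exists i.
(* A fibre embeds into the product of one small projection and the functions on the other
   coordinates of [F]. *)
have cardf f0 : f0 \in E -> (C * #|fiber f0| < #|T| ^ #|F|)%N.
  move=> f0E; have [i iF lt] := H f0 f0E.
  pose g (f : {ffun I -> T}) :=
    (f i, [ffun j => if j \in F :\ i then f j else y0]).
  have ginj : {in fiber f0 &, injective g}.
    move=> f f' /andP[_ /forallP hf] /andP[_ /forallP hf'] [e1 /ffunP e2].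
    apply/ffunP => j; have := e2 j; rewrite !ffunE !inE.
    have [-> //|ji] := eqVneq j i; have [//|jF] := boolP (j \in F) => _.
    have := hf j; have := hf' j; rewrite jF /= => /eqP -> /eqP -> //.
  have le : (#|fiber f0| <= #|proj f0 i| * #|T| ^ #|F|.-1)%N.
    rewrite -(card_in_imset ginj).
    have -> : #|F|.-1 = #|F :\ i| by rewrite (cardsD1 i F) iF.
    rewrite -(card_pffun_on y0 (mem (F :\ i)) (mem T)) -cardX.
    apply: subset_leq_card; apply/fintype.subsetP => _ /imsetP[f ff ->].
    rewrite !inE /=; apply/andP; split; first by apply/imsetP; exists f.
    apply/pffun_onP; split; last by move=> y _.
    by apply/fintype.subsetP => j; rewrite inE ffunE; case: ifP; rewrite ?eqxx.
  have F0 : (0 < #|F|)%N by apply/card_gt0P; exists i.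
  rewrite -(prednK F0) expnS; apply: leq_ltn_trans (leq_mul (leqnn C) le) _.
  by rewrite mulnA ltn_pmul2r // expn_gt0 T0.
(* [bl] forgets the coordinates in [F], so its values on [E] index the fibres; summing the strict
   bounds over them contradicts the density of [E]. *)
pose bl (f : {ffun I -> T}) := [ffun j => if j \in ~: F then f j else y0].
pose im := [set bl f | f : {ffun I -> T} in E].
have cim : (#|im| <= #|T| ^ #|~: F|)%N.
  rewrite -(card_pffun_on y0 (mem (~: F)) (mem T)).
  apply: subset_leq_card; apply/fintype.subsetP => _ /imsetP[f ff ->].
  apply/pffun_onP; split; last by move=> y _.
  by apply/fintype.subsetP => j; rewrite inE ffunE; case: ifP; rewrite ?eqxx.
have E0 : (0 < #|E|)%N.
  rewrite lt0n; apply/eqP => e; move: hE; rewrite e muln0 leqn0 expn_eq0.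
  by rewrite eqn0Ngt T0.
have im0 : (0 < #|im|)%N.
  have /card_gt0P[f fE] := E0.
  by apply/card_gt0P; exists (bl f); apply: imset_f.
have cE : (C * #|E| <= #|im| * (#|T| ^ #|F|).-1)%N.
  have -> : #|E| = (\sum_(b in im) \sum_(f in E | bl f == b) 1)%N.
    by rewrite -sum1_card (partition_big_imset bl).
  rewrite big_distrr /= -sum_nat_const.
  apply: leq_sum => _ /imsetP[f0 f0E ->].
  rewrite -ltnS prednK ?expn_gt0 ?T0 //; apply: leq_ltn_trans (cardf _ f0E).
  rewrite leq_mul2l sum1_card subset_leq_card ?orbT //.
  apply/fintype.subsetP => f; rewrite !inE => /andP[fE /eqP/ffunP e].
  apply/andP; split=> //; apply/forallP => j; apply/implyP => jF.
  by have := e j; rewrite !ffunE inE jF => ->.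
have := leq_trans hE (leq_trans cE (leq_mul cim (leqnn _))).
rewrite -(cardsC F) addnC expnD leq_pmul2l ?expn_gt0 ?T0 //.
by case: (_ ^ _)%N (expn_gt0 #|T| #|F|); rewrite ?T0 // => k _; rewrite ltnn.
Qed.

End Counting.

Section Clusters.
Variable T : eqType.
Implicit Types (c : T -> T -> T -> bool) (s : seq T).

Lemma path3_nthP c (x0 : T) s :
  reflect (forall i, (i.+2 < size s)%N ->
             c (nth x0 s i) (nth x0 s i.+1) (nth x0 s i.+2))
          (path3 c s).
Proof.
elim: s => [|x s IH]; first by apply: ReflectT => i.
apply: (iffP idP) => [/andP[cx ps] [|i]|h].
- by case: s cx {ps IH} => [//|y [//|z s]].
- exact: (elimT IH ps).
apply/andP; split; last by apply/IH => i; exact: (h i.+1).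
by case: s h {IH} => [//|y [//|z s]] /(_ 0%N isT).
Qed.

Lemma all3_nth c (x0 : T) s i j k : all3 c s -> (i < j)%N -> (j < k)%N ->
  (k < size s)%N -> c (nth x0 s i) (nth x0 s j) (nth x0 s k).
Proof.
elim: s i j k => [//|x s IH] [|i] [//|j] [//|k] /= /andP[px ps] ij jk ks.
  apply: (pairwiseP x0 px); rewrite ?inE //.
  exact: (@ltn_trans k j (size s) jk ks).
exact: IH.
Qed.

End Clusters.

(** * Extraction of the clusters from a point set *)

Section ClustersPlane.
Variable R : realType.
Implicit Types (p q r : plane R) (S : {fset plane R}).

(** For points in lexicographic order, [orient (sgnb b) p q r < 0] describes caps if [b] is [true]
    and cups if it is [false]. *)
Definition sgnb (b : bool) : R := if b then 1 else -1.

Lemma sgnb_neq0 b : sgnb b != 0.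
Proof. by case: b; rewrite /sgnb ?oppr_eq0 oner_eq0. Qed.

Lemma general_position_orient S s p q r : general_position S -> s != 0 ->
  p \in S -> q \in S -> r \in S -> p != q -> q != r -> p != r ->
  orient s p q r != 0.
Proof.
move=> gS s0 pS qS rS pq qr pr; apply/eqP => /(orient0_collinear s0 pq).
exact: gS.
Qed.

Lemma orient_sgnb S p q r : general_position S ->
  p \in S -> q \in S -> r \in S -> p != q -> q != r -> p != r ->
  (orient (sgnb true) p q r < 0) || (orient (sgnb false) p q r < 0).
Proof.
move=> gS pS qS rS pq qr pr.
have := general_position_orient gS (sgnb_neq0 true) pS qS rS pq qr pr.
by rewrite /sgnb orientN oppr_lt0 neq_lt.
Qed.

(* Cut the sorted points into [f] blocks.  Every choice of one point in each
   block contains a cap or a cup with [L.+2] points; by pigeonhole many choices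
   agree on its position, on its kind and on all points except those whose rank
   in it is [1] modulo [3].  Three consecutive points of the cap contain just
   one of these free points, so the free points may be varied independently. *)
Lemma clusters S (L M : nat) (f := 'C(L + L, L).+1) :
  general_position S -> (0 < M)%N -> #|` S| = (f * M)%N ->
  exists (b : bool) (Q : nat -> seq (plane R)),
    [/\ forall i, (i < L.+2)%N ->
          [/\ {subset Q i <= S}, uniq (Q i) & (0 < size (Q i))%N],
        forall i, (i < L.+2)%N -> (i %% 3 = 1)%N ->
          (M <= 2 * f ^ L.+2 * size (Q i))%N &
        forall i j k p q r, (i < j)%N -> (j < k)%N -> (k < L.+2)%N ->
          p \in Q i -> q \in Q j -> r \in Q k -> orient (sgnb b) p q r < 0].
Proof.
move=> gS M0 cS.
pose ps := sort (@lexle R) (enum_fset S).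
have sps : size ps = (f * M)%N by rewrite size_sort -cS.
have ups : uniq ps by rewrite sort_uniq fset_uniq.
have memps x : (x \in ps) = (x \in S) by rewrite mem_sort.
have pps : pairwise (@lexle R) ps.
  rewrite -sorted_pairwise; last exact: lexle_trans.
  exact: sort_sorted (@lexle_total R) _.
pose pt (i : 'I_f) (j : 'I_M) := nth 0 ps (i * M + j)%N.
have ltpt (i : 'I_f) (j : 'I_M) : (i * M + j < size ps)%N.
  rewrite sps; apply: (@leq_trans (i.+1 * M)%N).
    by rewrite mulSn addnC ltn_add2r.
  by rewrite leq_pmul2r.
have ptS i j : pt i j \in S by rewrite -memps mem_nth.
have ptlt (i i' : 'I_f) (j j' : 'I_M) : (i < i')%N ->
    lexle (pt i j) (pt i' j') /\ pt i j != pt i' j'.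
  move=> ii'; have lt : (i * M + j < i' * M + j')%N.
    apply: (@leq_trans (i.+1 * M)%N); first by rewrite mulSn addnC ltn_add2r.
    by rewrite (leq_trans _ (leq_addr _ _)) // leq_pmul2r.
  split; first by apply: (pairwiseP 0 pps); rewrite ?inE.
  by rewrite nth_uniq // ltn_eqF.
have ptinj i : injective (pt i).
  move=> j j' /eqP; rewrite nth_uniq // => /eqP /addnI; exact: val_inj.
pose col (t : {ffun 'I_f -> 'I_M}) b (i j k : 'I_f) :=
  orient (sgnb b) (pt i (t i)) (pt j (t j)) (pt k (t k)) < 0.
pose lto (i j : 'I_f) := (i < j)%N.
(* The position and the kind of the chain; the cardinality of [K] is the factor [2 * f ^ L.+2] of
   the statement. *)
pose K := ((L.+2).-tuple 'I_f * bool)%type.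
pose P (t : {ffun 'I_f -> 'I_M}) (k : K) :=
  sorted lto k.1 && path3 (col t k.2) k.1.
have PK t : exists k, P t k.
  have [||||u [_ su hu]] := @erdos_szekeres_triples _ lto (col t true)
    (col t false) L L (enum 'I_f).
  - exact: enum_uniq.
  - by move=> i j _ _ ij; rewrite -neq_ltn.
  - move=> i j k _ _ _ ij jk; have ik : (i < k)%N := ltn_trans ij jk.
    by apply: (orient_sgnb gS); rewrite ?ptS // (ptlt _ _ _ _ _).2.
  - by rewrite size_enum_ord.
  have [b [/eqP szu pu]] : exists b, size u == L.+2 /\ path3 (col t b) u.
    by case/orP: hu => /andP[]; [exists true|exists false].
  by exists (tcast szu (in_tuple u), b); rewrite /P /= val_tcast su.
have card0 : (0 < #|{ffun 'I_f -> 'I_M}|)%N.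
  by rewrite card_ffun !card_ord expn_gt0 M0.
have [[t b] /=] := pigeonhole_rel card0 PK.
rewrite card_ffun card_prod card_tuple card_bool [(_ * 2)%N]mulnC => hE.
have {}hE : (#|'I_M| ^ #|'I_f| <= 2 * f ^ L.+2 * #|[pred a | P a (t, b)]|)%N.
  by move: hE; rewrite !card_ord.
pose tn i : 'I_f := nth ord0 t i.
pose free i := (i %% 3 == 1)%N.
pose F := [set tn i | i : 'I_L.+2 & free i].
have M0' : (0 < #|'I_M|)%N by rewrite card_ord.
have [g0 g0E gF] := box_fiber F M0' hE.
have := g0E; rewrite inE /= => /andP[st _].
have tnlt i j : (i < j)%N -> (j < L.+2)%N -> (tn i < tn j)%N.
  move=> ij jL; have lto_tr : transitive lto by move=> ? ? ?; exact: ltn_trans.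
  move: st; rewrite (sorted_pairwise lto_tr) => /(pairwiseP ord0) h.
  by apply: (h i j); rewrite ?inE ?size_tuple // (ltn_trans ij).
have tninj i j : (i < L.+2)%N -> (j < L.+2)%N -> tn i = tn j -> i = j.
  move=> iL jL e; case: (ltngtP i j) => // ij.
    by have := tnlt _ _ ij jL; rewrite e ltnn.
  by have := tnlt _ _ ij iL; rewrite e ltnn.
have tnF i : (i < L.+2)%N -> (tn i \in F) = free i.
  move=> iL; apply/imsetP/idP => [[j fj e]|fi]; last first.
    by exists (Ordinal iL); rewrite ?inE.
  by rewrite (tninj _ _ iL (ltn_ord j) e); move: fj; rewrite inE.
pose G := [pred g | (g \in [pred a | P a (t, b)]) &&
  [forall j, (j \notin F) ==> (g j == g0 j)]].
pose Qs i := [set g (tn i) | g : {ffun 'I_f -> 'I_M} in G].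
have g0G : g0 \in G.
  by apply/andP; split=> //; apply/forallP => j; rewrite eqxx implybT.
pose Q i := if free i then [seq pt (tn i) x | x <- enum (Qs i)]
            else [:: pt (tn i) (g0 (tn i))].
exists b, Q; split.
- move=> i iL; rewrite /Q; case: ifP => fi; split => //.
  + by move=> _ /mapP[x _ ->].
  + by rewrite map_inj_uniq ?enum_uniq //; exact: ptinj.
  + rewrite size_map -cardE; apply/card_gt0P; exists (g0 (tn i)).
    by apply/imsetP; exists g0.
  + by move=> x; rewrite inE => /eqP ->.
- move=> i iL fi; rewrite /Q /free fi eqxx size_map -cardE.
  by have := gF (tn i); rewrite tnF // /free fi eqxx card_ord => /(_ isT).
move=> i j k p q r ij jk kL pQ qQ rQ.
have jL := ltn_trans jk kL; have iL := ltn_trans ij jL.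
have QG d z : (d < L.+2)%N -> z \in Q d ->
    exists2 g, g \in G & z = pt (tn d) (g (tn d)).
  move=> dL; rewrite /Q; case: ifP => fd.
    move=> /mapP[x]; rewrite mem_enum => /imsetP[g gG ->] ->.
    by exists g.
  by rewrite inE => /eqP ->; exists g0.
have Qfix d z g : (d < L.+2)%N -> ~~ free d -> z \in Q d -> g \in G ->
    z = pt (tn d) (g (tn d)).
  move=> dL fd; rewrite /Q (negPf fd) inE => /eqP ->.
  move=> /andP[_ /forallP/(_ (tn d))].
  by rewrite tnF // fd => /eqP ->.
(* A full transversal through [p], [q], [r]: once its consecutive triples are known to have the
   right sign, [orient_lex] extends this to all triples. *)
pose x d := if d == i then p else if d == j then q else if d == k then r
            else head 0 (Q d).
have xQ d : (d < L.+2)%N -> x d \in Q d.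
  move=> dL; rewrite /x; case: eqP => [->//|_]; case: eqP => [->//|_].
  case: eqP => [->//|_]; have : (0 < size (Q d))%N.
    rewrite /Q; case: ifP => // fd; rewrite size_map -cardE.
    by apply/card_gt0P; exists (g0 (tn d)); apply/imsetP; exists g0.
  by case: (Q d) => // z s _; rewrite mem_head.
have px : pairwise (@lexle R) (mkseq x L.+2).
  apply/(pairwiseP 0) => d e; rewrite !inE size_mkseq => dL eL de.
  rewrite !nth_mkseq //; have [g _ ->] := QG _ _ dL (xQ _ dL).
  have [h _ ->] := QG _ _ eL (xQ _ eL).
  by have [] := ptlt (tn d) (tn e) (g (tn d)) (h (tn e)) (tnlt _ _ de eL).
have p3 : path3 (fun u v w => orient (sgnb b) u v w < 0) (mkseq x L.+2).
  apply/(path3_nthP _ 0) => d; rewrite size_mkseq => dL.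
  have dL1 : (d.+1 < L.+2)%N by exact: ltn_trans dL.
  have dL0 : (d < L.+2)%N by exact: ltn_trans dL1.
  rewrite !nth_mkseq //.
  (* Slots that are not free hold the same point for every function in [G], so the [g] realising the
     free slot realises all three. *)
  have [g gG [-> -> ->]] : exists2 g, g \in G &
      [/\ x d = pt (tn d) (g (tn d)), x d.+1 = pt (tn d.+1) (g (tn d.+1)) &
          x d.+2 = pt (tn d.+2) (g (tn d.+2))].
    have [f0|f1|f2] : [\/ [/\ free d, ~~ free d.+1 & ~~ free d.+2],
        [/\ ~~ free d, free d.+1 & ~~ free d.+2] |
        [/\ ~~ free d, ~~ free d.+1 & free d.+2]].
    - rewrite /free; have : (d %% 3 < 3)%N by rewrite ltn_mod.
      have -> : (d.+1 %% 3 = (d %% 3 + 1) %% 3)%N by rewrite modnDml addn1.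
      have -> : (d.+2 %% 3 = (d %% 3 + 2) %% 3)%N by rewrite modnDml addn2.
      by case: (d %% 3)%N => [|[|[|]]] // _;
        [constructor 2|constructor 1|constructor 3].
    - have [g gG e] := QG _ _ dL0 (xQ _ dL0); case: f0 => _ n1 n2.
      by exists g => //; split=> //; apply: Qfix => //; exact: xQ.
    - have [g gG e] := QG _ _ dL1 (xQ _ dL1); case: f1 => n1 _ n2.
      by exists g => //; split=> //; apply: Qfix => //; exact: xQ.
    - have [g gG e] := QG _ _ dL (xQ _ dL); case: f2 => n1 n2 _.
      by exists g => //; split=> //; apply: Qfix => //; exact: xQ.
  move: gG => /andP[/andP[_ /(path3_nthP _ ord0) h] _].
  by apply: (h d); rewrite size_tuple.
have a3 : all3 (fun u v w => orient (sgnb b) u v w < 0) (mkseq x L.+2).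
  apply: (path3_all3 (P := predT)) px p3 => // u v w z _ pl h1 h2.
  by have [-> ->] := orient_lex pl h1 h2.
have := all3_nth 0 a3 ij jk; rewrite size_mkseq => /(_ kL).
rewrite !nth_mkseq // /x !eqxx (gtn_eqF ij) (gtn_eqF jk).
by rewrite (gtn_eqF (ltn_trans ij jk)).
Qed.

End ClustersPlane.

(** * Nested sets and caps in the clusters *)

Section Groups.
Variables (R : realType) (S : {fset plane R}) (s : R).
Hypotheses (s0 : s != 0) (gS : general_position S).
Implicit Types (a b p q r w : plane R) (Q t u : seq (plane R)).

Notation D := (orient s).

Lemma orient_distinct p q r : D p q r != 0 -> [/\ p != q, q != r & p != r].
Proof.
have e x y : [/\ D x x y = 0, D x y y = 0 & D x y x = 0].
  by split; rewrite /orient; ring.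
move=> H; split; apply: contra_neq H => ->.
- by have [] := e q r.
- by have [] := e p r.
- by have [] := e r q.
Qed.

(** * One cluster seen from two reference points *)

Section Cluster.
Variables (a b : plane R) (Q : seq (plane R)).
Hypotheses (aS : a \in S) (bS : b \in S) (QS : {subset Q <= S}).
Hypothesis ab : {in Q, forall p, D a p b < 0}.

Let ra p q := D a p q < 0.
Let rb p q := D b p q < 0.

(** [Q] lies on one side of the line through [a] and [b], so the angular order around [a] does not
    wrap around; the identity is a Grassmann-Plücker relation at [a]. *)
Lemma around_left_trans : {in Q & &, transitive ra}.
Proof.
move=> q p r qQ pQ rQ pq qr.
by apply: (neg_comb (ab qQ) (ab rQ) (ab pQ) _ pq qr); rewrite /orient; ring.
Qed.

Lemma around_right_trans : {in Q & &, transitive rb}.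
Proof.
move=> q p r qQ pQ rQ pq qr.
by apply: (neg_comb (ab qQ) (ab rQ) (ab pQ) _ pq qr); rewrite /orient; ring.
Qed.

Lemma around_left_neq0 p q : p \in Q -> q \in Q -> p != q -> D a p q != 0.
Proof.
move=> pQ qQ pq; apply: (general_position_orient gS s0) => //; rewrite ?QS //.
  by have [] := orient_distinct (ltr0_neq0 (ab pQ)).
by have [] := orient_distinct (ltr0_neq0 (ab qQ)).
Qed.

Lemma around_right_neq0 p q : p \in Q -> q \in Q -> p != q -> D b p q != 0.
Proof.
move=> pQ qQ pq; apply: (general_position_orient gS s0) => //; rewrite ?QS //.
  by rewrite eq_sym; have [] := orient_distinct (ltr0_neq0 (ab pQ)).
by rewrite eq_sym; have [] := orient_distinct (ltr0_neq0 (ab qQ)).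
Qed.

Lemma around_left_total : {in Q &, forall p q, p != q -> ra p q || ra q p}.
Proof.
move=> p q pQ qQ /(around_left_neq0 pQ qQ); rewrite /ra neq_lt.
case/orP=> [->//|h]; rewrite -(orient_rot s a q p) (orient_swap s p q a).
by rewrite (orient_rot s a p q) oppr_lt0 h orbT.
Qed.

Lemma around_left_neq p q : ra p q -> p != q.
Proof. by move=> /ltr0_neq0/orient_distinct[]. Qed.

(** As [lt] refines the angular order around [a], both signs pass from consecutive triples to all
    triples. [lt] will be this order or its intersection with the one around [b]. *)
Lemma cluster_es (lt : rel (plane R)) (k l : nat) t :
  uniq t -> {subset t <= Q} -> subrel lt ra -> {in t & &, transitive lt} ->
  {in t &, forall p q, p != q -> lt p q || lt q p} ->
  ('C(k + l, k) < size t)%N ->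
  exists u, [/\ {subset u <= t}, pairwise lt u, uniq u &
    (size u = k.+2 /\ all3 (fun x y z => 0 < D x y z) u) \/
    (size u = l.+2 /\ all3 (fun x y z => D x y z < 0) u)].
Proof.
move=> ut tQ ltra lttr lttot szt.
have [] := @erdos_szekeres_triples _ lt (fun x y z => 0 < D x y z)
  (fun x y z => D x y z < 0) k l t ut lttot _ szt.
  move=> x y z xt yt zt xy yz; rewrite orbC -neq_lt.
  have xz := lttr _ _ _ yt xt zt xy yz.
  by apply: (general_position_orient gS s0); rewrite ?QS ?tQ //;
    apply: around_left_neq; apply: ltra.
move=> u [us su hu].
have pu : pairwise lt u.
  by rewrite -(@sorted_pairwise_in _ (mem t)) //; apply/allP.
have pra : pairwise ra u by apply: sub_pairwise pu.
have uu : uniq u.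
  rewrite uniq_pairwise; apply: sub_pairwise pra => x y; exact: around_left_neq.
exists u; split=> //.
case/orP: hu => /andP[/eqP szu p3]; [left|right]; split=> //.
- apply: (path3_all3 (P := predT)) pra p3 => // x y z w _ pl h1 h2.
  by have [-> ->] := orient_around_pos pl h1 h2.
- apply: (path3_all3 (P := predT)) pra p3 => // x y z w _ pl h1 h2.
  by have [-> ->] := orient_around pl h1 h2.
Qed.

End Cluster.

(** The line through [p] and [q] separates [a] from [b], and a later [w] falls on the side of [b].
    In [right_cluster_side] an earlier [w] falls on the side of [a]. *)
Lemma left_cluster_side a b p q w :
  D a p q < 0 -> 0 < D b p q -> D a q b < 0 -> D a q w < 0 -> D q w b < 0 ->
  0 < D p q w.
Proof.
move=> h1 h2 h3 h4 h5.
have e : D a q b * D p q w = D a q w * D b p q - D a p q * D q w b.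
  by rewrite /orient; ring.
rewrite -(nmulr_rlt0 _ h3) e subr_lt0 (@lt_trans _ _ 0) //.
  by rewrite pmulr_llt0.
by rewrite nmulr_rgt0.
Qed.

Lemma right_cluster_side a b p q w :
  D a p q < 0 -> 0 < D b p q -> D a q b < 0 -> D a w q < 0 -> D w q b < 0 ->
  D p q w < 0.
Proof.
move=> h1 h2 h3 h4 h5.
have e : D a q b * D p q w = D a p q * D w q b - D a w q * D b p q.
  by rewrite /orient; ring.
rewrite -(nmulr_rgt0 _ h3) e subr_gt0 (@lt_trans _ _ 0) //.
  by rewrite pmulr_llt0.
by rewrite nmulr_rgt0.
Qed.

(** Around [a], the negative triples [p q b] and [q b w] combine. In [earlier_side], [w a p] and
    [a p q] combine around [b]. *)
Lemma later_side a b p q w :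
  D a p q < 0 -> D b p q < 0 -> D a p b < 0 -> D a q b < 0 ->
  D a p w < 0 -> D a q w < 0 -> D a b w < 0 -> D q b w < 0 -> D p q w < 0.
Proof.
move=> h1 h2 h3 h4 h5 h6 h7 h8.
have h9 : D p q b < 0 by rewrite orient_rot.
have [] // := @orient_around _ s a p q b w _ h9 h8.
by rewrite /= h1 h3 h4 h5 h6 h7.
Qed.

Lemma earlier_side a b p q w :
  D a p q < 0 -> D b p q < 0 -> D a p b < 0 -> D a q b < 0 ->
  D w p b < 0 -> D w q b < 0 -> D w a b < 0 -> D w a p < 0 -> D w p q < 0.
Proof.
move=> h1 h2 h3 h4 h5 h6 h7 h8.
have [] // := @orient_around _ s b w a p q _ h8 h1.
rewrite /= h2 -(orient_rot s b w a) -(orient_rot s b w p).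
rewrite -(orient_rot s b w q) -(orient_rot s b a p) -(orient_rot s b a q).
by rewrite h3 h4 h5 h6 h7.
Qed.

Definition has_gon (n : nat) : Prop :=
  exists T : {fset plane R}, (T `<=` S)%fset /\ convex_gon_vertices n T.

Lemma pos_gon n (w : seq (plane R)) :
  {subset w <= S} -> uniq w -> (2 < size w)%N ->
  (n <= size w)%N -> all3 (fun x y z => 0 < D x y z) w -> has_gon n.
Proof. by move=> wS uw w2 nw; exact: all3_gon wS w2 nw uw. Qed.

Lemma neg_gon n (w : seq (plane R)) :
  {subset w <= S} -> uniq w -> (2 < size w)%N ->
  (n <= size w)%N -> all3 (fun x y z => D x y z < 0) w -> has_gon n.
Proof.
move=> wS uw w2 nw aw; apply: (@all3_gon _ S n (- s) w) => //.
by apply: sub_all3 aw => x y z; rewrite orientN oppr_gt0.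
Qed.

(* [Q1] and [Q2] lie between [a] and [b] on a cap.  A large subset of [Q1] or
   [Q2] in which every line separates [a] from [b] is nested: its points seen
   from [a] and from [b] come in opposite orders.  A nested chain
   of [Q1] and one of [Q2] which bulge away from each other glue together to a
   convex polygon.  Without large nested subsets, some cluster contains a long
   list of points no line of which separates [a] from [b]. *)
Lemma group_dichotomy a b Q1 Q2 (n k : nat) :
  (0 < k)%N -> (n <= 8 * k)%N ->
  a \in S -> b \in S -> {subset Q1 <= S} -> {subset Q2 <= S} ->
  {in Q1, forall p, D a p b < 0} -> {in Q2, forall p, D a p b < 0} ->
  {in Q1 & Q2, forall p q, D a p q < 0 /\ D p q b < 0} ->
  uniq Q1 -> uniq Q2 ->
  ('C(9 * k, k) * 'C(12 * k, 4 * k) < size Q1)%N ->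
  ('C(9 * k, k) * 'C(12 * k, 4 * k) < size Q2)%N ->
  has_gon n \/
  exists u, [/\ {subset u <= Q1} \/ {subset u <= Q2}, uniq u, (k <= size u)%N,
    pairwise (fun p q => (D a p q < 0) && (D b p q < 0)) u &
    all3 (fun x y z => D x y z < 0) u].
Proof.
move=> k0 nk aS bS Q1S Q2S ab1 ab2 Q12 u1 u2 sz1 sz2.
have e8 : (2 < (8 * k).+2)%N by clear -k0; lia.
have n8 : (n <= (8 * k).+2)%N by clear -nk; lia.
have e44 : (2 < (4 * k).+2 + (4 * k).+2)%N by clear -k0; lia.
have n44 : (n <= (4 * k).+2 + (4 * k).+2)%N by clear -nk; lia.
have e12 : (4 * k + 8 * k = 12 * k)%N by rewrite -mulnDl.
have e12' : (8 * k + 4 * k = 12 * k)%N by rewrite -mulnDl.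
pose ra p q := D a p q < 0; pose rb p q := D b p q < 0.
pose nested (Q : seq (plane R)) := exists t,
  [/\ uniq t, {subset t <= Q}, ('C(12 * k, 4 * k) < size t)%N &
     {in t &, forall x y, ra x y -> ~~ rb x y}].
have dich Q : {subset Q <= S} -> {in Q, forall p, D a p b < 0} -> uniq Q ->
    ('C(9 * k, k) * 'C(12 * k, 4 * k) < size Q)%N ->
    nested Q \/ (has_gon n \/ exists u, [/\ {subset u <= Q}, uniq u,
      (k <= size u)%N, pairwise (fun p q => ra p q && rb p q) u &
      all3 (fun x y z => D x y z < 0) u]).
  move=> QS abQ uQ szQ.
  (* The chain has one point more than ['C(9 * k, k)]: enough for [8 * k + 2] points with positive
     triples or [k + 2] with negative ones. *)
  have [nest|[t [tQ szt st]]] := chain_or_free ra rb uQ szQ.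
    by left.
  right; pose rab p q := ra p q && rb p q.
  have tr : {in Q & &, transitive rab}.
    move=> q p r qQ pQ rQ /andP[pq1 pq2] /andP[qr1 qr2]; apply/andP; split.
      exact: (around_left_trans abQ qQ pQ rQ).
    exact: (around_right_trans abQ qQ pQ rQ).
  have trt : {in t & &, transitive rab}.
    by move=> q p r qt pt rt; apply: tr; exact: tQ.
  have pt : pairwise rab t.
    by rewrite -(@sorted_pairwise_in _ (mem t)) //; apply/allP.
  have ut : uniq t.
    rewrite uniq_pairwise; apply: sub_pairwise pt => x y /andP[xy _].
    exact: around_left_neq xy.
  have lttot := pairwise_total pt.
  have ss : subrel rab ra by move=> x y /andP[].
  have szt' : ('C(8 * k + k, 8 * k) < size t)%N.
    by rewrite szt ltnS -{1}mulSnr -bin_sub ?leq_mul2r ?orbT // -mulnBl mul1n.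
  have [u [ut' pu uu [[szu a3]|[szu a3]]]] :=
    cluster_es QS ut tQ ss trt lttot szt'.
    left; apply: (pos_gon _ uu _ _ a3); rewrite ?szu //.
    by move=> x /ut'/tQ/QS.
  right; exists u; split => //; last by rewrite szu ltnW.
  by move=> x /ut'/tQ.
have es Q (i j : nat) : {subset Q <= S} -> {in Q, forall p, D a p b < 0} ->
    nested Q -> (i + j = 12 * k)%N -> 'C(12 * k, i) = 'C(12 * k, 4 * k) ->
    exists u, [/\ {subset u <= Q},
      pairwise (fun p q => D a p q < 0) u,
      pairwise (fun p q => 0 < D b p q) u, uniq u &
      (size u = i.+2 /\ all3 (fun x y z => 0 < D x y z) u) \/
      (size u = j.+2 /\ all3 (fun x y z => D x y z < 0) u)].
  move=> QS abQ [t [ut tQ szt nt]] ij eC.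
  have tr : {in t & &, transitive ra}.
    by move=> q p r qt pt rt; apply: (around_left_trans abQ); exact: tQ.
  have tot : {in t &, forall p q, p != q -> ra p q || ra q p}.
    by move=> p q pt qt; apply: (around_left_total aS QS abQ); exact: tQ.
  have szt' : ('C(i + j, i) < size t)%N by rewrite ij eC.
  have [u [ut' pu uu hu]] :=
    cluster_es QS ut tQ (fun x y h => h) tr tot szt'.
  exists u; split => //; first by move=> x /ut'/tQ.
  apply: (sub_in_pairwise (P := mem u)) pu; last by apply/allP.
  move=> p q pu qu pq; have pq' := nt p q (ut' _ pu) (ut' _ qu) pq.
  have := around_right_neq0 bS QS abQ (tQ _ (ut' _ pu)) (tQ _ (ut' _ qu))
    (around_left_neq pq).
  by rewrite neq_lt => /orP[h|//]; rewrite /rb h in pq'.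
have [nest1|[?|[u [uQ uu ku pu au]]]] := dich Q1 Q1S ab1 u1 sz1; last 2 first.
- by left.
- by right; exists u; split=> //; left.
have [nest2|[?|[u [uQ uu ku pu au]]]] := dich Q2 Q2S ab2 u2 sz2; last 2 first.
- by left.
- by right; exists u; split=> //; right.
(* [4 * k] and [8 * k] are exchanged between the clusters. The longer chain is a polygon by itself,
   so a positive chain in [Q1] and a negative one in [Q2] remain. *)
have [|//|v1 [v1Q pa1 pb1 uv1 [[sv1 av1]|[sv1 av1]]]] :=
  es Q1 (4 * k)%N (8 * k)%N Q1S ab1 nest1; first exact: e12.
  2: left; apply: (neg_gon _ uv1 _ _ av1); rewrite ?sv1 //.
  2: by move=> x /v1Q/Q1S.
have [||v2 [v2Q pa2 pb2 uv2 [[sv2 av2]|[sv2 av2]]]] :=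
  es Q2 (8 * k)%N (4 * k)%N Q2S ab2 nest2.
- exact: e12'.
- by rewrite -[RHS]bin_sub ?leq_mul2r ?orbT // -mulnBl.
- left; apply: (pos_gon _ uv2 _ _ av2); rewrite ?sv2 //.
  by move=> x /v2Q/Q2S.
(* Reversal makes the triples of [v2] positive: the polygon runs along [v1] and returns along
   [v2]. *)
left; apply: (@pos_gon n (v1 ++ rev v2)).
- by move=> x; rewrite mem_cat mem_rev => /orP[/v1Q/Q1S|/v2Q/Q2S].
- rewrite cat_uniq uv1 rev_uniq uv2 andbT /=; apply/hasPn => x.
  rewrite mem_rev => /v2Q xQ2; apply/negP => /v1Q xQ1.
  by have [/around_left_neq] := Q12 x x xQ1 xQ2; rewrite eqxx.
- by rewrite size_cat size_rev sv1 sv2.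
- by rewrite size_cat size_rev sv1 sv2.
apply: all3_cat => //.
- rewrite all3_rev; apply: sub_all3 av2 => x y z.
  by rewrite -(orient_rot s z y x) (orient_swap s x y z) oppr_gt0.
- move=> z; rewrite mem_rev => /v2Q zQ2.
  have : pairwise (fun p q => (D a p q < 0) && (0 < D b p q)) v1.
    by rewrite pairwise_relI pa1.
  apply: (sub_in_pairwise (P := mem v1)); last by apply/allP.
  move=> p q /v1Q pQ /v1Q qQ /andP[h1 h2]; have [h3 h4] := Q12 q z qQ zQ2.
  exact: (left_cluster_side h1 h2 (ab1 _ qQ) h3 h4).
move=> x /v1Q xQ1; rewrite pairwise_rev.
have : pairwise (fun p q => (D a p q < 0) && (0 < D b p q)) v2.
  by rewrite pairwise_relI pa2.
apply: (sub_in_pairwise (P := mem v2)); last by apply/allP.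
move=> p q /v2Q pQ /v2Q qQ /andP[h1 h2]; have [h3 h4] := Q12 x q xQ1 qQ.
rewrite -(orient_rot s x q p) (orient_swap s p q x) oppr_gt0.
exact: (right_cluster_side h1 h2 (ab2 _ qQ) h3 h4).
Qed.

End Groups.

(** * Joining the caps of successive groups *)

Section Slots.
Variables (R : realType) (S : {fset plane R}) (s : R).
Hypotheses (s0 : s != 0) (gS : general_position S).
Variables (Q : nat -> seq (plane R)) (m : nat).
Hypothesis QS : forall i, (i < 6 * m)%N ->
  [/\ {subset Q i <= S}, uniq (Q i) & (0 < size (Q i))%N].

Notation D := (orient s).

Hypothesis capQ : forall i j k p q r, (i < j)%N -> (j < k)%N ->
  (k < 6 * m)%N -> p \in Q i -> q \in Q j -> r \in Q k -> D p q r < 0.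

Lemma slots_disjoint i j k p q : (i < j)%N -> (j < k)%N -> (k < 6 * m)%N ->
  p \in Q i -> q \in Q j -> p != q.
Proof.
move=> ij jk km pQ qQ; have [_ _] := QS km.
case: (Q k) (fun r => @capQ i j k p q r ij jk km pQ qQ) => [//|r t] h _.
by have /(_ (mem_head _ _))/ltr0_neq0/orient_distinct[] := h r.
Qed.

Lemma cap_chain (n k : nat) :
  (n <= m * k)%N -> (2 < m * k)%N ->
  (forall g, (g < m)%N ->
    exists2 ab, ab.1 \in Q (6 * g)%N /\ ab.2 \in Q (6 * g + 5)%N &
    exists i u, [/\ (6 * g < i < 6 * g + 5)%N /\ {subset u <= Q i}, uniq u,
      (k <= size u)%N,
      pairwise (fun p q => (D ab.1 p q < 0) && (D ab.2 p q < 0)) u &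
      all3 (fun x y z => D x y z < 0) u]) ->
  has_gon S n.
Proof.
move=> nm m2 H.
(* The last clause carries the induction: each point of a later slot forms negative triples with the
   pairs of [v]. Pairs inside one cap are handled by [earlier_side] and [later_side], other mixed
   triples by [capQ]. *)
suff chain h : (h <= m)%N -> exists v,
    [/\ uniq v, (h * k <= size v)%N,
      forall x, x \in v -> exists2 i, (i < 6 * h)%N & x \in Q i,
      all3 (fun x y z => D x y z < 0) v &
      forall j w, (6 * h <= j)%N -> (j < 6 * m)%N -> w \in Q j ->
        pairwise (fun p q => D p q w < 0) v].
  have [v [uv sv vQ av _]] := chain m (leqnn m).
  apply: (neg_gon _ uv _ _ av); [|exact: leq_trans sv|exact: leq_trans sv].
  by move=> x /vQ[i im]; have [+ _ _] := QS im; apply.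
elim: h => [|h IH] hm; first by exists [::]; split.
have [v [uv sv vQ av pv]] := IH (ltnW hm).
have [[a b] /= [aQ bQ] [i [u [[/andP[i1 i2] uQ] uu su uab au]]]] := H h hm.
have e6 : (6 * h.+1 = 6 * h + 6)%N by rewrite mulnSr.
have hm6 : (6 * h + 6 <= 6 * m)%N by rewrite -e6 leq_mul2l.
have h5 : (6 * h + 5 < 6 * m)%N by clear -hm6; lia.
have h0 : (6 * h < 6 * m)%N by clear -hm6; lia.
have im : (i < 6 * m)%N by clear -i2 hm6; lia.
have bi : {in Q i, forall p, D a p b < 0}.
  by move=> p pQ; apply: (capQ i1 i2 h5).
exists (v ++ u); split.
- rewrite cat_uniq uv uu andbT /=; apply/hasPn => x /uQ xQ; apply/negP.
  move=> /vQ[j jh xQj]; have ji : (j < i)%N by exact: ltn_trans i1.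
  by have := slots_disjoint ji i2 h5 xQj xQ; rewrite eqxx.
- by rewrite size_cat mulSnr leq_add.
- move=> x; rewrite mem_cat => /orP[/vQ[j jh xQj]|/uQ xQ].
    by exists j => //; rewrite e6 ltn_addr.
  by exists i => //; clear -i2 e6; lia.
- apply: all3_cat => // [z /uQ zQ|x /vQ[j jh xQj]].
    exact: pv (ltnW i1) im zQ.
  apply: (sub_in_pairwise (P := mem u)) uab; last by apply/allP.
  move=> p q /uQ pQ /uQ qQ /andP[h1 h2].
  apply: (earlier_side h1 h2 (bi _ pQ) (bi _ qQ)).
  + exact: capQ (ltn_trans jh i1) i2 h5 xQj pQ bQ.
  + exact: capQ (ltn_trans jh i1) i2 h5 xQj qQ bQ.
  + exact: capQ jh (ltn_trans i1 i2) h5 xQj aQ bQ.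
  + exact: capQ jh i1 im xQj aQ pQ.
move=> j w; rewrite e6 => hj jm wQ.
have j5 : (6 * h + 5 < j)%N by clear -hj; lia.
have ij : (i < j)%N by exact: ltn_trans j5.
rewrite pairwise_cat (pv j w) ?(leq_trans _ hj) ?leq_addr //=.
apply/andP; split.
  apply/allrelP => p q /vQ[l lh pQ] /uQ qQ.
  exact: capQ (ltn_trans lh i1) ij jm pQ qQ wQ.
apply: (sub_in_pairwise (P := mem u)) uab; last by apply/allP.
move=> p q /uQ pQ /uQ qQ /andP[h1 h2].
apply: (later_side h1 h2 (bi _ pQ) (bi _ qQ)).
- exact: capQ i1 ij jm aQ pQ wQ.
- exact: capQ i1 ij jm aQ qQ wQ.
- exact: capQ (ltn_trans i1 i2) j5 jm aQ bQ wQ.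
- exact: capQ i2 j5 jm qQ bQ wQ.
Qed.

(* Six consecutive slots form a group: the large ones, of ranks 1 and 4, lie
   between reference points taken in the slots of ranks 0 and 5. *)
Lemma slots_gon (n k : nat) :
  (0 < k)%N -> (n <= 8 * k)%N -> (n <= m * k)%N -> (2 < m * k)%N ->
  (forall i, (i < 6 * m)%N -> (i %% 3 = 1)%N ->
     ('C(9 * k, k) * 'C(12 * k, 4 * k) < size (Q i))%N) ->
  has_gon S n.
Proof.
move=> k0 nk nm m2 szQ; have [//|nog] := pselect (has_gon S n).
apply: (@cap_chain n k nm m2) => g gm.
have hm6 : (6 * g + 6 <= 6 * m)%N by rewrite -mulnSr leq_mul2l.
have [l0 l1 l4 l5] : [/\ 6 * g < 6 * m, 6 * g + 1 < 6 * m, 6 * g + 4 < 6 * m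
    & 6 * g + 5 < 6 * m]%N by clear -hm6; split; lia.
have [l01 l14 l45] : [/\ 6 * g < 6 * g + 1, 6 * g + 1 < 6 * g + 4
    & 6 * g + 4 < 6 * g + 5]%N by clear; split; lia.
have [r1 r4] : ((6 * g + 1) %% 3 = 1)%N /\ ((6 * g + 4) %% 3 = 1)%N.
  by clear; split; lia.
have [Q0S _ _] := QS l0; have [Q1S u1 _] := QS l1.
have [Q4S u4 _] := QS l4; have [Q5S _ _] := QS l5.
have [a aQ] : exists a, a \in Q (6 * g)%N.
  have [_ _] := QS l0; case: (Q _) => // a t _; exists a; exact: mem_head.
have [b bQ] : exists b, b \in Q (6 * g + 5)%N.
  have [_ _] := QS l5; case: (Q _) => // b t _; exists b; exact: mem_head.
have ab1 : {in Q (6 * g + 1)%N, forall p, D a p b < 0}.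
  by move=> p pQ; apply: (capQ l01 (ltn_trans l14 l45) l5).
have ab4 : {in Q (6 * g + 4)%N, forall p, D a p b < 0}.
  by move=> p pQ; apply: (capQ (ltn_trans l01 l14) l45 l5).
have ab14 : {in Q (6 * g + 1)%N & Q (6 * g + 4)%N,
    forall p q, D a p q < 0 /\ D p q b < 0}.
  move=> p q pQ qQ; split; first exact: capQ l01 l14 l4 _ _ _.
  exact: capQ l14 l45 l5 _ _ _.
have [//|[u [uQ uu ku pu au]]] := group_dichotomy s0 gS k0 nk (Q0S _ aQ)
  (Q5S _ bQ) Q1S Q4S ab1 ab4 ab14 u1 u4 (szQ _ l1 r1) (szQ _ l4 r4).
exists (a, b) => //; case: uQ => uQ.
  exists (6 * g + 1)%N, u; split=> //; split=> //.
  by rewrite l01 (ltn_trans l14).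
exists (6 * g + 4)%N, u; split=> //; split=> //.
by rewrite (ltn_trans l01).
Qed.

End Slots.

(** * A number of points that forces the polygon *)

Lemma forces_convex_gon_bound (R : realType) :
  exists C : nat, (0 < C)%N /\ forall n k : nat, (0 < k)%N -> (n <= 8 * k)%N ->
    forces_convex_gon R n (C * ('C(9 * k, k) * 'C(12 * k, 4 * k)).+1).
Proof.
(* Eight groups of six slots; [L] is kept abstract so that ['C(L + L, L)] stays symbolic. *)
have [L eL] : exists L, L.+2 = (6 * 8)%N by exists 46%N.
pose f := 'C(L + L, L).+1; pose e := (2 * f ^ L.+2)%N.
have e0 : (0 < e)%N by rewrite muln_gt0 expn_gt0.
exists (f * e)%N; split; first by rewrite muln_gt0 e0.
move=> n k k0 nk S cS gS; set X := ('C(9 * k, k) * 'C(12 * k, 4 * k))%N in cS.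
(* Blocks of [e * X.+1] points lose at most the factor [e], so the large slots keep more than [X]
   points. *)
have M0 : (0 < e * X.+1)%N by rewrite muln_gt0 e0.
rewrite -mulnA in cS.
have [b [Q [QS Qsz capQ]]] := clusters gS M0 cS.
rewrite eL in QS Qsz capQ.
apply: (@slots_gon R S (sgnb R b) (sgnb_neq0 R b) gS Q 8 QS capQ n k) => //.
  by rewrite (@leq_trans 8) // leq_pmulr.
move=> i i6 i3; have := Qsz i i6 i3.
by rewrite -eL -/f -/e leq_pmul2l.
Qed.

(** * Asymptotics *)

(** The left side is one term of the binomial expansion of the right side. *)
Lemma bin_expn_le (a b i : nat) :
  ('C(i * (a + b), i * b) * a ^ (i * a) <= (a + 1) ^ (i * (a + b)))%N.
Proof.
rewrite expnDn.
have lt : (i * b < (i * (a + b)).+1)%N by rewrite ltnS leq_mul2l leq_addl orbT.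
rewrite (bigD1 (Ordinal lt)) //= exp1n muln1.
by rewrite -mulnBr addnK leq_addr.
Qed.

Lemma bin_product_le (k : nat) :
  ('C(9 * k, k) * 'C(12 * k, 4 * k) * 2 ^ (32 * k) <= 3 ^ (30 * k))%N.
Proof.
have h1 : ('C(9 * k, k) * 2 ^ (24 * k) <= 3 ^ (18 * k))%N.
  (* The base 8 fits the proportion of 1 in 9, and 2 below that of 1 in 3; both bounds become powers
     of 2 and 3. *)
  have := bin_expn_le 8 1 k.
  have -> : (k * (8 + 1) = 9 * k)%N by rewrite mulnC.
  have -> : (8 ^ (k * 8) = 2 ^ (24 * k))%N.
    by rewrite [X in (X ^ _)%N](_ : 8 = 2 ^ 3)%N // -expnM; congr expn; lia.
  have -> : ((8 + 1) ^ (9 * k) = 3 ^ (18 * k))%N.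
    by rewrite [X in (X ^ _)%N](_ : _ = 3 ^ 2)%N // -expnM mulnA.
  by rewrite muln1.
have h2 : ('C(12 * k, 4 * k) * 2 ^ (8 * k) <= 3 ^ (12 * k))%N.
  have := bin_expn_le 2 1 (4 * k).
  have -> : (4 * k * (2 + 1) = 12 * k)%N by rewrite mulnC mulnA.
  have -> : (4 * k * 2 = 8 * k)%N by rewrite mulnC mulnA.
  by rewrite muln1.
have := leq_mul h1 h2; rewrite mulnACA -!expnD -!mulnDl.
by [].
Qed.

(** With [j = n - 3] this is the denominator of the ratio. The induction step amounts to
    [4 * (j + 1) <= 2 * (2 * j + 3)]. *)
Lemma bin_central_ge (j : nat) : (4 ^ j <= j.+1 * 'C(j.*2.+1, j.+1))%N.
Proof.
elim: j => [//|j IH].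
have e1 : 'C(j.*2.+2, j.+1) = (2 * 'C(j.*2.+1, j.+1))%N.
  rewrite binS mulSn mul1n; congr (_ + _)%N; rewrite -addnn.
  by rewrite -bin_sub ?leqW ?leq_addr // subSn ?leq_addr // addnK.
have := mul_bin_diag j.*2.+3 j.+1; rewrite succnK e1 doubleS => <-.
rewrite expnS; apply: leq_trans (leq_mul (leqnn 4) IH) _.
rewrite !mulnA leq_mul2r; apply/orP; right; clear; lia.
Qed.

Section Asymptotics.
Variable R : realType.

(** Absorbs the linear factor of [bin_central_ge] into the geometric rate. *)
Lemma nat_le_geometric (k : nat) : (k%:R : R) <= 4 * (5 / 4) ^+ k.
Proof.
elim: k => [|k IH]; first by rewrite expr0; lra.
have : (1 : R) <= (5 / 4) ^+ k by apply: exprn_ege1; lra.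
by rewrite exprS -[k.+1%:R]natr1; lra.
Qed.

Lemma ratio_geometric_le (C f n : nat) (k := (n %/ 8).+1) : (8 <= n)%N ->
  (f <= C * ('C(9 * k, k) * 'C(12 * k, 4 * k)).+1)%N ->
  (f%:R / 'C(2 * n - 5, n - 2)%:R : R)
    <= C%:R * 4 ^+ 14 * (5 / 4 * (3 ^+ 30 / 2 ^+ 48)) ^+ k.
Proof.
move=> n8 fle; set B := 'C(_, _).
set X := ('C(9 * k, k) * 'C(12 * k, 4 * k))%N in fle.
have kn : (8 * k <= 11 + (n - 3))%N by clear -n8; rewrite /k; lia.
have nk : (n - 3 < 8 * k)%N by clear -n8; rewrite /k; lia.
have hB : (4 ^ (n - 3) <= (n - 3).+1 * B)%N.
  have -> : B = 'C((n - 3).*2.+1, (n - 3).+1) by congr binomial; clear -n8; lia.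
  exact: bin_central_ge.
have B0 : (0 < B)%N by rewrite bin_gt0; clear -n8; lia.
have X0 : (0 < X)%N.
  by rewrite muln_gt0 !bin_gt0 leq_pmull // leq_mul2r orbT.
have hX : (X%:R : R) * 2 ^+ (32 * k) <= 3 ^+ (30 * k).
  by rewrite -!natrX -natrM ler_nat; exact: bin_product_le.
(* Rounding [n] up to [8 * k] costs at most [4 ^+ 11], since [8 * k <= n + 8]. *)
have hB' : (2 : R) ^+ (16 * k) <= 4 ^+ 11 * (8 * k%:R * B%:R).
  have -> : (2 : R) ^+ (16 * k) = 4 ^+ (8 * k).
    by rewrite (_ : 4 = 2 ^+ 2 :> R) -?exprM ?mulnA //; ring.
  apply: (@le_trans _ _ (4 ^+ (11 + (n - 3)))).
    by rewrite ler_weXn2l //; lra.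
  rewrite exprD ler_pM2l ?exprn_gt0 //.
  rewrite -!natrM -natrX ler_nat; apply: leq_trans hB _.
  by rewrite leq_mul2r nk orbT.
have fX : (f%:R : R) <= C%:R * (2 * X%:R).
  rewrite -!natrM ler_nat; apply: leq_trans fle _.
  by rewrite leq_mul2l mul2n -addnn -addn1 leq_add2l X0 orbT.
have B0' : (0 : R) < B%:R by rewrite ltr0n.
rewrite ler_pdivrMr //; apply: le_trans fX _.
rewrite exprMn [(3 ^+ 30 / _) ^+ k]expr_div_n -!exprM.
have p2 i : (0 : R) < 2 ^+ i by rewrite exprn_gt0.
have hk := nat_le_geometric k.
suff : (X%:R : R) * 2 ^+ (48 * k) <=
    4 ^+ 11 * (32 * (5 / 4) ^+ k * B%:R) * 3 ^+ (30 * k).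
  rewrite -ler_pdivlMr // => h.
  rewrite [leRHS](_ : _ = C%:R * (2 *
    (4 ^+ 11 * (32 * (5 / 4) ^+ k * B%:R) * 3 ^+ (30 * k) / 2 ^+ (48 * k)))).
    by rewrite ler_wpM2l // ler_pM2l.
  (* The remaining [4 ^+ 3] is [2 * 32]. *)
  rewrite (_ : 14 = 11 + 3)%N // exprD.
  move: (4 ^+ 11 : R) ((5 / 4) ^+ k : R) (3 ^+ _ : R) (2 ^+ _)^-1 => x y t w.
  by ring.
have -> : (48 * k = 32 * k + 16 * k)%N by rewrite -mulnDl.
rewrite exprD mulrA mulrC.
apply: le_trans (ler_pM (ltW (p2 _)) _ hB' hX) _.
  by rewrite mulr_ge0 // ltW.
rewrite ler_pM2r ?exprn_gt0 // ler_pM2l ?exprn_gt0 // ler_pM2r //; lra.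
Qed.

Lemma limn_esup_le_near (u : (\bar R)^nat) (l : \bar R) :
  (\forall n \near \oo%classic, u n <= l)%E -> (limn_esup u <= l)%E.
Proof.
case=> N _ h; rewrite /limn_esup limf_esupE; apply: ge_ereal_inf.
exists (ereal_sup (u @` [set n | (N <= n)%N])%classic).
  by exists [set n | (N <= n)%N]%classic => //; exists N.
by apply: ge_ereal_sup => _ [n /= Nn <-]; exact: h.
Qed.

Lemma ratio_limn_esup_le (C : nat) (f : nat -> nat) :
  (forall n k, (0 < k)%N -> (n <= 8 * k)%N ->
    (f n <= C * ('C(9 * k, k) * 'C(12 * k, 4 * k)).+1)%N) ->
  (limn_esup (fun n : nat =>
     ((f n)%:R / 'C(2 * n - 5, n - 2)%:R)%:E : \bar R) <= (29 / 32)%:E)%E.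
Proof.
(* [3 ^+ 30 / 2 ^+ 48] is about 0.73, so the factor [5 / 4] still leaves [z < 1]. *)
move=> fle; set z : R := 5 / 4 * (3 ^+ 30 / 2 ^+ 48).
have z0 : 0 <= z by rewrite /z; lra.
have z1 : `|z| < 1 by rewrite ger0_norm // /z; lra.
have cz : (C%:R * 4 ^+ 14 * z ^+ k @[k --> \oo] --> (0 : R))%classic.
  have := cvgM (cvg_cst (C%:R * 4 ^+ 14 : R)) (cvg_expr z1).
  by rewrite mulr0; apply.
have e0 : (0 : R) < 29 / 32 by lra.
move/cvgr0Pnorm_le: cz => /(_ _ e0)[N _ hN].
apply: limn_esup_le_near; exists (8 * N.+1)%N => // n /= Nn.
rewrite lee_fin; apply: le_trans (@ratio_geometric_le C (f n) n _ _) _.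
- by apply: leq_trans Nn; rewrite leq_pmulr.
- by apply: fle => //; rewrite mulnC ltnW // ltn_ceil.
have kN : (N <= (n %/ 8).+1)%N.
  rewrite ltnW // ltnS leq_divRL // mulnC (leq_trans _ Nn) //.
  by rewrite leq_mul2l ltnW ?orbT.
exact: le_trans (ler_norm _) (hN _ kN).
Qed.

End Asymptotics.

Theorem theorem7 (R : realType) :
  exists f : nat -> nat,
    (forall n : nat, is_smallest_forcing R n (f n)) /\
    (limn_esup (fun n : nat =>
       ((f n)%:R / 'C(2 * n - 5, n - 2)%:R)%:E : \bar R)
     <= (29 / 32)%:E)%E.
Proof.
have [C [C0 forced]] := forces_convex_gon_bound R.
pose P n m := `[< (0 < m)%N /\ forces_convex_gon R n m >].
have bound n k : (0 < k)%N -> (n <= 8 * k)%N ->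
    P n (C * ('C(9 * k, k) * 'C(12 * k, 4 * k)).+1)%N.
  by move=> k0 nk; apply/asboolP; split; [rewrite muln_gt0 C0|exact: forced].
have exP n : exists m, P n m.
  (* The choice [k = n.+1] is positive even for [n = 0]. *)
  have le : (n <= 8 * n.+1)%N by rewrite (leq_trans (leqnSn n)) // leq_pmull.
  by eexists; exact: bound le.
exists (fun n => ex_minn (exP n)); split=> [n|].
  case: ex_minnP => m /asboolP[m0 mP] m_min; split=> // k k0 kP.
  by apply: m_min; apply/asboolP.
apply: (@ratio_limn_esup_le R C) => n k k0 nk.
by case: ex_minnP => m _; apply; exact: bound.
Qed.
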